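(* Let $G$ be a finite group, let $L \leq G$ be a perfect subgroup and let $e_L \in A(G)$ be the corresponding primitive idempotent of the Burnside ring. Fix subgroups $K \leq H \leq G$. Then the norm map $N_K^H \colon A(K) \to A(H)$ descends to a well-defined map of multiplicative monoids \[ \tilde{N}_K^H \colon A(K)[e_L^{-1}] \to A(H)[e_L^{-1}] \] if and only if the following holds: ($\star$) whenever $L' \leq H$ is conjugate in $G$ to $L$, then $L'$ is contained in $K$.
   Context: For $H \leq G$, $A(H)$ is the Burnside ring of finite $H$-sets, $R^G_H\colon A(G)\to A(H)$ is the ring homomorphism given by restriction of actions, and for $K \leq H$ the norm $N_K^H \colon A(K) \to A(H)$ is the multiplicative (non-additive) map given on finite $K$-sets by co-induction $X \mapsto \mathrm{Map}_K(H,X)$, extended to virtual sets in the standard way (it is the norm of the Tambara functor $A(-)$). For $Q\leq H$ the mark $\phi^Q\colon A(H)\to\mathbb{Z}$ is the ring homomorphism with $\phi^Q([S])=|S^Q|$ for finite $H$-sets $S$; the marks are jointly injective. For a finite group $Q$, $O^{\mathrm{solv}}(Q)$ is the unique minimal normal subgroup of $Q$ with solvable quotient; $Q$ is perfect iff $Q=O^{\mathrm{solv}}(Q)$. By Dress, conjugacy classes of perfect subgroups $L\le G$ correspond bijectively to primitive idempotents $e_L\in A(G)$, where $\phi^Q(e_L)=1$ if $O^{\mathrm{solv}}(Q)$ is conjugate in $G$ to $L$, and $\phi^Q(e_L)=0$ otherwise. For $H \leq G$, $A(H)[e_L^{-1}]$ denotes the localization of the ring $A(H)$ at the element $R^G_H(e_L)$.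 ''$N_K^H$ descends to a map of multiplicative monoids $\tilde N_K^H$'' means that there is a map of multiplicative monoids $\tilde N_K^H$ whose precomposition with the localization map $A(K) \to A(K)[e_L^{-1}]$ equals $N_K^H$ followed by the localization map $A(H)\to A(H)[e_L^{-1}]$. *)

(* Defs.v *)
From HB Require Import structures.
From mathcomp Require Import all_boot all_order all_algebra all_fingroup.
From mathcomp Require Import all_solvable boolp ring zify.

Set Implicit Arguments.
Unset Strict Implicit.
Unset Printing Implicit Defensive.

Import GRing.Theory.

Local Open Scope group_scope.
Local Open Scope quotient_scope.

(* [repr] alone refers to the representative of a subset of a group. *)
Local Notation quot_repr := generic_quotient.repr.

(* Finite H-sets are right H-sets, i.e. actions [to : action H T] with T a
   finType; the usual left H-sets correspond to them by  h x := to x h^-1. *)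

Section EquivariantBijections.

Variables (gT : finGroupType) (H : {group gT}).
Implicit Types T U V W : finType.

Definition gset_iso T U (a : action H T) (b : action H U) : Prop :=
  exists f : T -> U,
    bijective f /\ {in H, forall h x, f (a x h) = b (f x) h}.

Lemma gset_iso_refl T (a : action H T) : gset_iso a a.
Proof. by exists id; split=> //; exists id. Qed.

Lemma gset_iso_sym T U (a : action H T) (b : action H U) :
  gset_iso a b -> gset_iso b a.
Proof.
case=> f [[g fK gK] fJ]; exists g; split; first by exists f.
by move=> h hH x; apply: (can_inj fK); rewrite gK fJ // gK.
Qed.

Lemma gset_iso_trans T U V (b : action H U) (a : action H T) (c : action H V) :
  gset_iso a b -> gset_iso b c -> gset_iso a c.
Proof.
case=> f [f_bij fJ] [g [g_bij gJ]]; exists (g \o f).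
by split=> [|h hH x]; [exact: bij_comp | rewrite /= fJ // gJ].
Qed.

Definition zero_fun (x : void) (_ : gT) : void := x.
Lemma zero_is_action : is_action H zero_fun.
Proof. by split=> // x. Qed.
Definition zero_act : action H void := Action zero_is_action.

Definition one_fun (x : unit) (_ : gT) : unit := x.
Lemma one_is_action : is_action H one_fun.
Proof. by split=> // h; exact: inj_id. Qed.
Definition one_act : action H unit := Action one_is_action.

Section SumProduct.

Variables (T U : finType) (a : action H T) (b : action H U).

Definition sum_fun (z : T + U) (h : gT) : T + U :=
  match z with inl x => inl (a x h) | inr y => inr (b y h) end.
Lemma sum_is_action : is_action H sum_fun.
Proof.
split=> [h [x|y] [x'|y'] //= [] /act_inj -> //|].
by case=> [x|y] h k hH kH /=; rewrite actMin.
Qed.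
Definition sum_act : action H (T + U)%type := Action sum_is_action.

Definition prod_fun (z : T * U) (h : gT) : T * U := (a z.1 h, b z.2 h).
Lemma prod_is_action : is_action H prod_fun.
Proof.
split=> [h [x y] [x' y'] /= [] /act_inj -> /act_inj -> //|].
by case=> [x y] h k hH kH; rewrite /prod_fun /= !actMin.
Qed.
Definition prod_act : action H (T * U)%type := Action prod_is_action.

End SumProduct.

Lemma sum_iso T T' U U' (a : action H T) (a' : action H T')
    (b : action H U) (b' : action H U') :
  gset_iso a a' -> gset_iso b b' -> gset_iso (sum_act a b) (sum_act a' b').
Proof.
case=> f [[f' fK f'K] fJ] [g [[g' gK g'K] gJ]].
exists (fun z => match z with inl x => inl (f x) | inr y => inr (g y) end).
split; last by move=> h hH [x|y] /=; rewrite ?fJ ?gJ.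
exists (fun z => match z with inl x => inl (f' x) | inr y => inr (g' y) end).
  by case=> [x|y]; rewrite ?fK ?gK.
by case=> [x|y]; rewrite ?f'K ?g'K.
Qed.

Lemma prod_iso T T' U U' (a : action H T) (a' : action H T')
    (b : action H U) (b' : action H U') :
  gset_iso a a' -> gset_iso b b' -> gset_iso (prod_act a b) (prod_act a' b').
Proof.
case=> f [[f' fK f'K] fJ] [g [[g' gK g'K] gJ]].
exists (fun z => (f z.1, g z.2)).
split; last by move=> h hH [x y]; rewrite /= /prod_fun /= fJ // gJ.
exists (fun z => (f' z.1, g' z.2)).
  by case=> [x y] /=; rewrite fK gK.
by case=> [x y] /=; rewrite f'K g'K.
Qed.

(* A small model of the class of finite H-sets: a finite H-set carried by 'I_n
   is a map gT -> 'S_n that is multiplicative on H. *)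
Definition perm_family := {n : nat & {ffun gT -> 'S_n}}.

Record hset := HSet {
  hset_val : perm_family;
  _ : [forall h in H, forall k in H,
        tagged hset_val (h * k) == tagged hset_val h * tagged hset_val k] }.

HB.instance Definition _ := [isSub for hset_val].
HB.instance Definition _ := [Choice of hset by <:].

Section ActionOfHset.

Variable X : hset.

Definition hset_fun (i : 'I_(tag (hset_val X))) (h : gT) : 'I_(tag (hset_val X)) :=
  tagged (hset_val X) h i.
Lemma hset_is_action : is_action H hset_fun.
Proof.
split=> [h i j /perm_inj //|i h k hH kH]; rewrite /hset_fun.
by have /forall_inP/(_ h hH)/forall_inP/(_ k kH)/eqP-> := valP X; rewrite permM.
Qed.
Definition hset_act : action H 'I_(tag (hset_val X)) := Action hset_is_action.

End ActionOfHset.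

Section HsetOfAction.

Variables (T : finType) (a : action H T).

Let perm_fun (h : gT) (i : 'I_#|T|) : 'I_#|T| := enum_rank (a (enum_val i) h).
Let perm_fun_inj h : injective (perm_fun h).
Proof. by move=> i j /enum_rank_inj/act_inj/enum_val_inj. Qed.

Let family : perm_family :=
  Tagged (fun n => {ffun gT -> 'S_n}) [ffun h => perm (@perm_fun_inj h)].

Let familyM : [forall h in H, forall k in H,
  tagged family (h * k) == tagged family h * tagged family k].
Proof.
apply/forall_inP=> h hH; apply/forall_inP=> k kH; apply/eqP/permP=> i.
by rewrite permM !ffunE !permE /perm_fun enum_rankK actMin.
Qed.

Definition hset_of : hset := HSet familyM.

Lemma hset_of_iso : gset_iso (hset_act hset_of) a.
Proof.
exists (enum_val : 'I_#|T| -> T).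
split; first by exists enum_rank; [exact: enum_valK | exact: enum_rankK].
by move=> h hH i; rewrite /= /hset_fun /= ffunE permE enum_rankK.
Qed.

End HsetOfAction.


Definition hset_rel : rel hset :=
  fun X Y => `[< gset_iso (hset_act X) (hset_act Y) >].

Lemma hset_rel_refl : reflexive hset_rel.
Proof. by move=> X; apply/asboolP; exact: gset_iso_refl. Qed.
Lemma hset_rel_sym : symmetric hset_rel.
Proof. by move=> X Y; apply/asboolP/asboolP; exact: gset_iso_sym. Qed.
Lemma hset_rel_trans : transitive hset_rel.
Proof.
move=> Y X Z /asboolP XY /asboolP YZ; apply/asboolP.
exact: gset_iso_trans XY YZ.
Qed.

Canonical hset_equiv :=
  EquivRel hset_rel hset_rel_refl hset_rel_sym hset_rel_trans.

End EquivariantBijections.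

Section IsoClasses.

Variables (gT : finGroupType) (H : {group gT}).

Definition iso_class := {eq_quot @hset_equiv gT H}.
HB.instance Definition _ := EqQuotient.on iso_class.
HB.instance Definition _ := Choice.on iso_class.

Definition iso_cls (T : finType) (a : action H T) : iso_class :=
  \pi_iso_class (hset_of a).

Definition repr_act (c : iso_class) := hset_act (quot_repr c).

Lemma iso_clsP (T U : finType) (a : action H T) (b : action H U) :
  iso_cls a = iso_cls b <-> gset_iso a b.
Proof.
have aa := hset_of_iso a; have bb := hset_of_iso b.
split=> [/eqmodP/asboolP ab | ab].
  exact: gset_iso_trans (gset_iso_sym aa) (gset_iso_trans ab bb).
apply/eqmodP/asboolP.
exact: gset_iso_trans aa (gset_iso_trans ab (gset_iso_sym bb)).
Qed.

Lemma repr_actK c : iso_cls (repr_act c) = c.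
Proof.
rewrite -[RHS]reprK; apply/eqmodP/asboolP; exact: hset_of_iso.
Qed.

Lemma repr_act_cls (T : finType) (a : action H T) :
  gset_iso (repr_act (iso_cls a)) a.
Proof. by apply/iso_clsP; rewrite repr_actK. Qed.

Lemma iso_class_ind (P : iso_class -> Prop) :
  (forall (T : finType) (a : action H T), P (iso_cls a)) -> forall c, P c.
Proof. by move=> Pcls c; rewrite -(repr_actK c). Qed.

Definition iso_add (c d : iso_class) := iso_cls (sum_act (repr_act c) (repr_act d)).
Definition iso_mul (c d : iso_class) := iso_cls (prod_act (repr_act c) (repr_act d)).
Definition iso_zero := iso_cls (zero_act H).
Definition iso_one := iso_cls (one_act H).

Lemma iso_addE (T U : finType) (a : action H T) (b : action H U) :
  iso_add (iso_cls a) (iso_cls b) = iso_cls (sum_act a b).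
Proof. by apply/iso_clsP/sum_iso; exact: repr_act_cls. Qed.
Lemma iso_mulE (T U : finType) (a : action H T) (b : action H U) :
  iso_mul (iso_cls a) (iso_cls b) = iso_cls (prod_act a b).
Proof. by apply/iso_clsP/prod_iso; exact: repr_act_cls. Qed.

Lemma iso_addA : associative iso_add.
Proof.
elim/iso_class_ind=> T a; elim/iso_class_ind=> U b; elim/iso_class_ind=> V c.
rewrite !iso_addE; apply/iso_clsP.
exists (fun z => match z with inl x => inl (inl x) | inr (inl y) => inl (inr y)
                            | inr (inr z) => inr z end).
split; last by move=> h hH [x|[y|z]].
by exists (fun z => match z with inl (inl x) => inl x | inl (inr y) => inr (inl y)
                         | inr z => inr (inr z) end); [case=> [|[]] | case=> [[]|]].
Qed.

Lemma iso_addC : commutative iso_add.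
Proof.
elim/iso_class_ind=> T a; elim/iso_class_ind=> U b.
rewrite !iso_addE; apply/iso_clsP.
exists (fun z => match z with inl x => inr x | inr y => inl y end).
split; last by move=> h hH [].
by exists (fun z => match z with inl x => inr x | inr y => inl y end); case.
Qed.

Lemma iso_add0 : left_id iso_zero iso_add.
Proof.
elim/iso_class_ind=> T a; rewrite iso_addE; apply/iso_clsP.
exists (fun z => match z with inl x => of_void T x | inr y => y end).
by split; [exists inr; [case|] | move=> h hH []].
Qed.

Lemma iso_mulA : associative iso_mul.
Proof.
elim/iso_class_ind=> T a; elim/iso_class_ind=> U b; elim/iso_class_ind=> V c.
rewrite !iso_mulE; apply/iso_clsP; exists (fun z => (z.1, z.2.1, z.2.2)).
split; last by move=> h hH [x [y z]].
by exists (fun z => (z.1.1, (z.1.2, z.2))); [case=> [? []] | case=> [[]]].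
Qed.

Lemma iso_mulC : commutative iso_mul.
Proof.
elim/iso_class_ind=> T a; elim/iso_class_ind=> U b.
rewrite !iso_mulE; apply/iso_clsP; exists (fun z => (z.2, z.1)).
by split; [exists (fun z => (z.2, z.1)); case | move=> h hH []].
Qed.

Lemma iso_mul1 : left_id iso_one iso_mul.
Proof.
elim/iso_class_ind=> T a; rewrite iso_mulE; apply/iso_clsP; exists snd.
by split; [exists (pair tt); [case=> [[]]|] | move=> h hH []].
Qed.

Lemma iso_mulD : left_distributive iso_mul iso_add.
Proof.
elim/iso_class_ind=> T a; elim/iso_class_ind=> U b; elim/iso_class_ind=> V c.
rewrite !(iso_addE, iso_mulE); apply/iso_clsP.
exists (fun z => match z.1 with inl x => inl (x, z.2)
                              | inr y => inr (y, z.2) end).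
split; last by move=> h hH [[x|y] z].
exists (fun z => match z with inl u => (inl u.1, u.2)
                            | inr u => (inr u.1, u.2) end).
  by case=> [[]].
by case=> [[]|[]].
Qed.

Lemma iso_mul0 : left_zero iso_zero iso_mul.
Proof.
elim/iso_class_ind=> T a; rewrite iso_mulE; apply/iso_clsP; exists fst.
split; last by move=> h hH [[]].
by exists (of_void (void * T)%type); [case=> [[]] | case].
Qed.

HB.instance Definition _ :=
  GRing.isNmodule.Build iso_class iso_addA iso_addC iso_add0.
HB.instance Definition _ :=
  GRing.Nmodule_isComPzSemiRing.Build iso_class
    iso_mulA iso_mulC iso_mul1 iso_mulD iso_mul0.

End IsoClasses.

Section GrothendieckRing.

Local Open Scope ring_scope.

Variable S : comPzSemiRingType.
Implicit Types (a b c d : S) (p q r : S * S).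

Definition groth_rel : rel (S * S) :=
  fun p q => `[< exists z, p.1 + q.2 + z = q.1 + p.2 + z >].

Lemma groth_rel_refl : reflexive groth_rel.
Proof. by move=> p; apply/asboolP; exists 0. Qed.
Lemma groth_rel_sym : symmetric groth_rel.
Proof. by move=> p q; apply/asboolP/asboolP=> -[z zE]; exists z. Qed.
Lemma groth_rel_trans : transitive groth_rel.
Proof.
move=> q p r /asboolP[z zE] /asboolP[w wE]; apply/asboolP.
exists (q.1 + q.2 + z + w).
transitivity ((p.1 + q.2 + z) + (q.1 + r.2 + w)); first by ring.
by rewrite zE wE; ring.
Qed.

Canonical groth_equiv :=
  EquivRel groth_rel groth_rel_refl groth_rel_sym groth_rel_trans.

Definition groth := {eq_quot groth_equiv}.
HB.instance Definition _ := EqQuotient.on groth.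
HB.instance Definition _ := Choice.on groth.

(* The formal difference a - b. *)
Definition gdiff a b : groth := \pi_groth (a, b).

Definition gpos (x : groth) : S := (quot_repr x).1.
Definition gneg (x : groth) : S := (quot_repr x).2.

Lemma gdiffP a b c d :
  gdiff a b = gdiff c d <-> exists z, a + d + z = c + b + z.
Proof. by split=> [/eqmodP/asboolP|?]; last apply/eqmodP/asboolP. Qed.

Lemma gdiffK x : gdiff (gpos x) (gneg x) = x.
Proof. by rewrite /gdiff -surjective_pairing reprK. Qed.

Lemma gdiff_repr a b : exists z, gpos (gdiff a b) + b + z = a + gneg (gdiff a b) + z.
Proof. by apply/gdiffP; rewrite gdiffK. Qed.

Lemma groth_ind (P : groth -> Prop) :
  (forall a b, P (gdiff a b)) -> forall x, P x.
Proof. by move=> PD x; rewrite -(gdiffK x). Qed.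

Definition groth_add (x y : groth) :=
  gdiff (gpos x + gpos y) (gneg x + gneg y).
Definition groth_opp (x : groth) := gdiff (gneg x) (gpos x).
Definition groth_mul (x y : groth) :=
  gdiff (gpos x * gpos y + gneg x * gneg y) (gpos x * gneg y + gneg x * gpos y).

Lemma groth_addE a b c d :
  groth_add (gdiff a b) (gdiff c d) = gdiff (a + c) (b + d).
Proof.
have [z zE] := gdiff_repr a b; have [w wE] := gdiff_repr c d.
apply/gdiffP; exists (z + w).
set a' := gpos _ in zE *; set b' := gneg _ in zE *.
set c' := gpos _ in wE *; set d' := gneg _ in wE *.
transitivity ((a' + b + z) + (c' + d + w)); first by ring.
by rewrite zE wE; ring.
Qed.

Lemma groth_oppE a b : groth_opp (gdiff a b) = gdiff b a.
Proof.
have [z zE] := gdiff_repr a b; apply/gdiffP; exists z.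
by rewrite [_ + a]addrC -zE [b + _]addrC.
Qed.

Lemma groth_mulE a b c d :
  groth_mul (gdiff a b) (gdiff c d) = gdiff (a * c + b * d) (a * d + b * c).
Proof.
have [z zE] := gdiff_repr a b; have [w wE] := gdiff_repr c d; rewrite /groth_mul.
set a' := gpos _ in zE *; set b' := gneg _ in zE *.
set c' := gpos _ in wE *; set d' := gneg _ in wE *.
transitivity (gdiff (a * c' + b * d') (a * d' + b * c')).
  apply/gdiffP; exists (z * c' + z * d').
  transitivity ((a' + b + z) * c' + (a + b' + z) * d'); first by ring.
  transitivity ((a + b' + z) * c' + (a' + b + z) * d'); first by rewrite zE.
  by ring.
apply/gdiffP; exists (w * a + w * b).
transitivity ((c' + d + w) * a + (c + d' + w) * b); first by ring.
transitivity ((c + d' + w) * a + (c' + d + w) * b); first by rewrite wE.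
by ring.
Qed.

Lemma groth_addA : associative groth_add.
Proof.
elim/groth_ind=> a b; elim/groth_ind=> c d; elim/groth_ind=> e f.
by rewrite !groth_addE !addrA.
Qed.

Lemma groth_addC : commutative groth_add.
Proof.
elim/groth_ind=> a b; elim/groth_ind=> c d.
by rewrite !groth_addE addrC (addrC b).
Qed.

Lemma groth_add0 : left_id (gdiff 0 0) groth_add.
Proof. by elim/groth_ind=> a b; rewrite groth_addE !add0r. Qed.

Lemma groth_addN : left_inverse (gdiff 0 0) groth_opp groth_add.
Proof.
elim/groth_ind=> a b; rewrite groth_oppE groth_addE; apply/gdiffP; exists 0.
by ring.
Qed.

Lemma groth_mulA : associative groth_mul.
Proof.
elim/groth_ind=> a b; elim/groth_ind=> c d; elim/groth_ind=> e f.
by rewrite !groth_mulE; congr gdiff; ring.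
Qed.

Lemma groth_mulC : commutative groth_mul.
Proof.
elim/groth_ind=> a b; elim/groth_ind=> c d.
by rewrite !groth_mulE; congr gdiff; ring.
Qed.

Lemma groth_mul1 : left_id (gdiff 1 0) groth_mul.
Proof.
by elim/groth_ind=> a b; rewrite groth_mulE !mul1r !mul0r !addr0.
Qed.

Lemma groth_mulD : left_distributive groth_mul groth_add.
Proof.
elim/groth_ind=> a b; elim/groth_ind=> c d; elim/groth_ind=> e f.
by rewrite !(groth_mulE, groth_addE); congr gdiff; ring.
Qed.

HB.instance Definition _ :=
  GRing.isZmodule.Build groth groth_addA groth_addC groth_add0 groth_addN.
HB.instance Definition _ :=
  GRing.Zmodule_isComPzRing.Build groth groth_mulA groth_mulC groth_mul1 groth_mulD.

Definition gclass a : groth := gdiff a 0.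

Lemma gdiffE a b : gdiff a b = gclass a - gclass b.
Proof.
rewrite /gclass; transitivity (groth_add (gdiff a 0) (groth_opp (gdiff b 0))) => //.
by rewrite groth_oppE groth_addE addr0 add0r.
Qed.

Lemma gclassD a b : gclass (a + b) = gclass a + gclass b.
Proof. by rewrite -[RHS]/(groth_add _ _) groth_addE addr0. Qed.

Lemma gclassM a b : gclass (a * b) = gclass a * gclass b.
Proof. by rewrite -[RHS]/(groth_mul _ _) groth_mulE !(mulr0, mul0r, addr0). Qed.

End GrothendieckRing.

Section Localization.

Local Open Scope ring_scope.

Variables (R : comPzRingType) (s : R).
Implicit Types (a b : R) (m n k : nat) (p q r : R * nat).

(* The pair (a, n) stands for the fraction a / s ^+ n. *)
Definition loc_rel : rel (R * nat) :=
  fun p q =>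
    `[< exists k, s ^+ k * (s ^+ q.2 * p.1) = s ^+ k * (s ^+ p.2 * q.1) >].

Lemma loc_rel_refl : reflexive loc_rel.
Proof. by move=> p; apply/asboolP; exists 0. Qed.
Lemma loc_rel_sym : symmetric loc_rel.
Proof. by move=> p q; apply/asboolP/asboolP=> -[k kE]; exists k. Qed.
Lemma loc_rel_trans : transitive loc_rel.
Proof.
move=> q p r /asboolP[k kE] /asboolP[l lE]; apply/asboolP.
exists (k + l + q.2)%N; rewrite !exprD.
transitivity (s ^+ l * s ^+ r.2 * (s ^+ k * (s ^+ q.2 * p.1))); first by ring.
rewrite kE.
transitivity (s ^+ k * s ^+ p.2 * (s ^+ l * (s ^+ r.2 * q.1))); first by ring.
by rewrite lE; ring.
Qed.

Canonical loc_equiv := EquivRel loc_rel loc_rel_refl loc_rel_sym loc_rel_trans.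

Definition loc := {eq_quot loc_equiv}.
HB.instance Definition _ := EqQuotient.on loc.
HB.instance Definition _ := Choice.on loc.

Definition lfrac a n : loc := \pi_loc (a, n).
Definition lnum (x : loc) : R := (quot_repr x).1.
Definition lexp (x : loc) : nat := (quot_repr x).2.

Lemma lfracP a n b m :
  lfrac a n = lfrac b m <->
  exists k, s ^+ k * (s ^+ m * a) = s ^+ k * (s ^+ n * b).
Proof. by split=> [/eqmodP/asboolP|?]; last apply/eqmodP/asboolP. Qed.

Lemma lfracK x : lfrac (lnum x) (lexp x) = x.
Proof. by rewrite /lfrac -surjective_pairing reprK. Qed.

Lemma lfrac_repr a n : exists k,
  s ^+ k * (s ^+ n * lnum (lfrac a n)) = s ^+ k * (s ^+ lexp (lfrac a n) * a).
Proof. by apply/lfracP; rewrite lfracK. Qed.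

Lemma loc_ind (P : loc -> Prop) :
  (forall a n, P (lfrac a n)) -> forall x, P x.
Proof. by move=> PD x; rewrite -(lfracK x). Qed.

Definition loc_add (x y : loc) :=
  lfrac (s ^+ lexp y * lnum x + s ^+ lexp x * lnum y) (lexp x + lexp y).
Definition loc_opp (x : loc) := lfrac (- lnum x) (lexp x).
Definition loc_mul (x y : loc) := lfrac (lnum x * lnum y) (lexp x + lexp y).

Lemma loc_addE a n b m :
  loc_add (lfrac a n) (lfrac b m) = lfrac (s ^+ m * a + s ^+ n * b) (n + m).
Proof.
have [k kE] := lfrac_repr a n; have [l lE] := lfrac_repr b m.
rewrite /loc_add; apply/lfracP; exists (k + l)%N.
set a' := lnum _ in kE *; set n' := lexp _ in kE *.
set b' := lnum _ in lE *; set m' := lexp _ in lE *.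
clearbody a' n' b' m'.
rewrite !exprD.
transitivity (s ^+ l * s ^+ m * s ^+ m' * (s ^+ k * (s ^+ n * a'))
  + s ^+ k * s ^+ n * s ^+ n' * (s ^+ l * (s ^+ m * b'))); first by ring.
by rewrite kE lE; ring.
Qed.

Lemma loc_oppE a n : loc_opp (lfrac a n) = lfrac (- a) n.
Proof.
have [k kE] := lfrac_repr a n; apply/lfracP; exists k.
by rewrite !mulrN kE.
Qed.

Lemma loc_mulE a n b m :
  loc_mul (lfrac a n) (lfrac b m) = lfrac (a * b) (n + m).
Proof.
have [k kE] := lfrac_repr a n; have [l lE] := lfrac_repr b m.
rewrite /loc_mul; apply/lfracP; exists (k + l)%N.
set a' := lnum _ in kE *; set n' := lexp _ in kE *.
set b' := lnum _ in lE *; set m' := lexp _ in lE *.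
clearbody a' n' b' m'.
rewrite !exprD.
transitivity ((s ^+ k * (s ^+ n * a')) * (s ^+ l * (s ^+ m * b'))); first by ring.
by rewrite kE lE; ring.
Qed.

Lemma loc_addA : associative loc_add.
Proof.
elim/loc_ind=> a n; elim/loc_ind=> b m; elim/loc_ind=> c k.
by rewrite !loc_addE addnA !exprD; congr lfrac; ring.
Qed.

Lemma loc_addC : commutative loc_add.
Proof.
by elim/loc_ind=> a n; elim/loc_ind=> b m; rewrite !loc_addE addnC addrC.
Qed.

Lemma loc_add0 : left_id (lfrac 0 0) loc_add.
Proof. by elim/loc_ind=> a n; rewrite loc_addE mulr0 add0r mul1r. Qed.

Lemma loc_addN : left_inverse (lfrac 0 0) loc_opp loc_add.
Proof.
elim/loc_ind=> a n; rewrite loc_oppE loc_addE; apply/lfracP; exists 0.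
by ring.
Qed.

Lemma loc_mulA : associative loc_mul.
Proof.
elim/loc_ind=> a n; elim/loc_ind=> b m; elim/loc_ind=> c k.
by rewrite !loc_mulE mulrA addnA.
Qed.

Lemma loc_mulC : commutative loc_mul.
Proof.
by elim/loc_ind=> a n; elim/loc_ind=> b m; rewrite !loc_mulE mulrC addnC.
Qed.

Lemma loc_mul1 : left_id (lfrac 1 0) loc_mul.
Proof. by elim/loc_ind=> a n; rewrite loc_mulE mul1r. Qed.

Lemma loc_mulD : left_distributive loc_mul loc_add.
Proof.
elim/loc_ind=> a n; elim/loc_ind=> b m; elim/loc_ind=> c k.
rewrite !(loc_addE, loc_mulE); apply/lfracP; exists 0; rewrite !exprD; ring.
Qed.

HB.instance Definition _ :=
  GRing.isZmodule.Build loc loc_addA loc_addC loc_add0 loc_addN.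
HB.instance Definition _ :=
  GRing.Zmodule_isComPzRing.Build loc loc_mulA loc_mulC loc_mul1 loc_mulD.

Definition to_loc a : loc := lfrac a 0.

Lemma to_loc_is_zmod_morphism : zmod_morphism to_loc.
Proof.
move=> a b; rewrite -[RHS]/(loc_add _ (loc_opp _)) loc_oppE loc_addE.
by rewrite !mul1r.
Qed.
Lemma to_loc_is_monoid_morphism : monoid_morphism to_loc.
Proof. by split=> // a b; rewrite -[RHS]/(loc_mul _ _) loc_mulE. Qed.
HB.instance Definition _ :=
  GRing.isZmodMorphism.Build R loc to_loc to_loc_is_zmod_morphism.
HB.instance Definition _ :=
  GRing.isMonoidMorphism.Build R loc to_loc to_loc_is_monoid_morphism.

Lemma to_loc_inv : to_loc s * lfrac 1 1 = 1.
Proof.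
rewrite -[LHS]/(loc_mul _ _) loc_mulE; apply/lfracP; exists 0; ring.
Qed.

End Localization.

Section FixedPoints.

Variables (gT : finGroupType) (H : {group gT}).
Implicit Types (T U : finType) (Q : {group gT}).

Lemma card_fix_iso T U (a : action H T) (b : action H U) Q :
  Q \subset H -> gset_iso a b -> #|'Fix_a(Q)| = #|'Fix_b(Q)|.
Proof.
move=> /subsetP sQH [f [[g fK gK] fJ]].
rewrite -(card_imset _ (can_inj fK)); apply: eq_card => y.
apply/imsetP/afixP=> [[x /afixP xQ ->] q qQ | yQ].
  by rewrite -fJ ?sQH // xQ.
exists (g y); last by rewrite gK.
by apply/afixP=> q qQ; apply: (can_inj fK); rewrite fJ ?sQH // gK yQ.
Qed.

Lemma card_fix_sum T U (a : action H T) (b : action H U) Q :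
  #|'Fix_(sum_act a b)(Q)| = (#|'Fix_a(Q)| + #|'Fix_b(Q)|)%N.
Proof.
rewrite -(card_imset _ (@inl_inj T U)) -(card_imset _ (@inr_inj T U)).
set A := inl @: _; set B := inr @: _.
have AB0 : A :&: B = set0.
  by apply/setP=> z; rewrite !inE; apply/andP=> -[/imsetP[x _ ->] /imsetP[]].
rewrite -cardsUI AB0 cards0 addn0; apply: eq_card=> z.
rewrite in_setU; apply/afixP/orP; case: z => [x|y].
- by move=> xQ; left; apply/imset_f/afixP=> q /xQ[].
- by move=> yQ; right; apply/imset_f/afixP=> q /yQ[].
- by case=> /imsetP[z /afixP zQ] // [->] q /zQ /= ->.
- by case=> /imsetP[z /afixP zQ] // [->] q /zQ /= ->.
Qed.

Lemma card_fix_prod T U (a : action H T) (b : action H U) Q :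
  #|'Fix_(prod_act a b)(Q)| = (#|'Fix_a(Q)| * #|'Fix_b(Q)|)%N.
Proof.
rewrite -cardsX; apply: eq_card=> -[x y]; rewrite in_setX /=.
apply/afixP/andP=> [xyQ | [/afixP xQ /afixP yQ] q qQ]; last first.
  by rewrite /= /prod_fun /= xQ ?yQ.
by split; apply/afixP=> q /xyQ [].
Qed.

Section FixedPointsInjective.

Variables (T U : finType) (a : action H T) (b : action H U).

Let stable (V : finType) (c : action H V) (C : {set V}) :=
  forall h x, h \in H -> x \in C -> c x h \in C.

Let iso_on (A : {set T}) (B : {set U}) (f : T -> U) :=
  [/\ {in A &, injective f}, f @: A = B &
      forall h x, h \in H -> x \in A -> f (a x h) = b (f x) h].

Let stabE (V : finType) (c : action H V) v h :
  (h \in 'C_H[v | c]) = (h \in H) && (c v h == v).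
Proof. by rewrite !inE sub1set inE andbA andbb. Qed.

Let stable_mem (V : finType) (c : action H V) (C : {set V}) h x :
  stable c C -> h \in H -> (c x h \in C) = (x \in C).
Proof.
move=> sC hH; apply/idP/idP=> [xhC|]; last exact: sC.
by rewrite -[x](actKin c hH) sC ?groupV.
Qed.

Let card_fix_iso_on A B f Q : Q \subset H -> stable a A -> iso_on A B f ->
  #|'Fix_(A | a)(Q)| = #|'Fix_(B | b)(Q)|.
Proof.
move=> /subsetP sQH stA [f_inj fA fJ].
have f_injI : {in 'Fix_(A | a)(Q) &, injective f}.
  by move=> x y /setIP[xA _] /setIP[yA _]; exact: f_inj.
rewrite -(card_in_imset f_injI); apply: eq_card=> y.
apply/imsetP/setIP=> [[x /setIP[xA /afixP xQ] ->] | [yB /afixP yQ]].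
  split; first by rewrite -fA imset_f.
  by apply/afixP=> q qQ; rewrite -fJ ?sQH // xQ.
move: yB yQ; rewrite -fA => /imsetP[x xA ->] yQ; exists x => //.
apply/setIP; split=> //; apply/afixP=> q qQ.
by apply: f_inj; rewrite ?stA ?sQH // fJ ?sQH // yQ.
Qed.

Let orbit_iso x y : 'C_H[x | a] = 'C_H[y | b] ->
  exists f, iso_on (orbit a H x) (orbit b H y) f.
Proof.
move=> Cxy; pose t z := odflt 1 [pick h in H | a x h == z].
have tP h : h \in H -> t (a x h) \in H /\ a x (t (a x h)) = a x h.
  move=> hH; rewrite /t; case: pickP => [k /andP[kH /eqP]|/(_ h)] //=.
  by rewrite hH eqxx.
have stab h k : h \in H -> k \in H -> (a x h = a x k <-> b y h = b y k).
  move=> hH kH; have kV : k^-1 \in H by rewrite groupV.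
  have fixE (V : finType) (c : action H V) v :
      c v h = c v k <-> h * k^-1 \in 'C_H[v | c].
    rewrite stabE groupM //=; split=> [vhk | /eqP].
      by rewrite actMin // vhk actKin.
    rewrite actMin // => /(congr1 (c^~ k)).
    by rewrite -[k in c _ k]invgK actKin ?groupV.
  by rewrite !fixE Cxy.
exists (fun z => b y (t z)); split.
- move=> _ _ /orbitP[h hH <-] /orbitP[k kH <-].
  have [tH th] := tP h hH; have [tK tk] := tP k kH.
  by move=> /stab; rewrite th tk; apply.
- apply/setP=> z; apply/imsetP/orbitP=> [[_ /orbitP[h hH <-] ->]|[h hH <-]].
    by have [tH th] := tP h hH; exists (t (a x h)).
  have [tH th] := tP h hH; exists (a x h); first exact: mem_orbit.
  by apply/esym/stab.
- move=> k _ kH /orbitP[h hH <-]; rewrite -actMin //.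
  have [tH th] := tP h hH; have [tHK thk] := tP (h * k) (groupM hH kH).
  by rewrite -actMin //; apply/stab; rewrite ?groupM // thk !actMin // th.
Qed.

Let stable_orbitD (V : finType) (c : action H V) (C : {set V}) x :
  stable c C -> stable c (C :\: orbit c H x).
Proof.
move=> sC h z hH /setDP[zC zx]; apply/setDP; split; first exact: sC.
apply: contra zx => /orbitP[k kH ckz]; apply/orbitP; exists (k * h^-1).
  by rewrite groupM ?groupV.
by rewrite actMin ?groupV // ckz actKin.
Qed.

Let sub_orbit (V : finType) (c : action H V) (C : {set V}) x :
  stable c C -> x \in C -> orbit c H x \subset C.
Proof. by move=> sC xC; apply/subsetP=> _ /orbitP[h hH <-]; exact: sC. Qed.

Let stable_orbit (V : finType) (c : action H V) x : stable c (orbit c H x).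
Proof.
move=> h _ hH /orbitP[k kH <-]; rewrite -actMin //.
by apply/mem_orbit/groupM.
Qed.

Let card_fixD (V : finType) (c : action H V) (O C : {set V}) Q : O \subset C ->
  #|'Fix_(C :\: O | c)(Q)| = (#|'Fix_(C | c)(Q)| - #|'Fix_(O | c)(Q)|)%N.
Proof.
move=> sOC; rewrite setIDAC cardsD -setIA ['Fix_c(Q) :&: O]setIC setIA.
by rewrite (setIidPr sOC).
Qed.

Let iso_on_ind (u0 : U) n (A : {set T}) (B : {set U}) : (#|A| <= n)%N ->
  stable a A -> stable b B ->
  (forall Q, Q \subset H -> #|'Fix_(A | a)(Q)| = #|'Fix_(B | b)(Q)|) ->
  exists f, iso_on A B f.
Proof.
elim: n A B => [|n IHn] A B; last have [->|[x0 x0A]] := set_0Vmem A.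
- rewrite leqn0 cards_eq0 => /eqP-> _ _ AB; exists (fun=> u0).
  split=> [x y|//|h x _]; rewrite ?in_set0 //; rewrite imset0.
  have:= AB 1%G (sub1G H); rewrite set0I cards0 => /esym/cards0_eq B0.
  apply/esym/setP=> y; have:= congr1 (fun C : {set U} => y \in C) B0.
  by rewrite !inE sub1set inE act1 eqxx andbT.
- move=> _ _ _ AB; exists (fun=> u0).
  split=> [x y|//|h x _]; rewrite ?in_set0 //; rewrite imset0.
  have:= AB 1%G (sub1G H); rewrite set0I cards0 => /esym/cards0_eq B0.
  apply/esym/setP=> y; have:= congr1 (fun C : {set U} => y \in C) B0.
  by rewrite !inE sub1set inE act1 eqxx andbT.
move=> leAn stA stB AB.
pose P (Q : {group gT}) := (Q \subset H) && ('Fix_(A | a)(Q) != set0).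
have P1 : P 1%G.
  rewrite /P sub1G; apply/set0Pn; exists x0; rewrite inE x0A.
  by apply/afixP=> h /set1P->; rewrite act1.
case: (@arg_maxnP _ 1%G P (fun Q : {group gT} => #|Q|) P1) => Q /andP[sQH].
case/set0Pn=> x /setIP[xA /afixP xQ] maxQ.
have /card_gt0P[y /setIP[yB /afixP yQ]] : (0 < #|'Fix_(B | b)(Q)|)%N.
  by rewrite -AB //; apply/card_gt0P; exists x; rewrite inE xA; apply/afixP.
have CxQ : 'C_H[x | a] = Q.
  apply/esym/eqP; rewrite eqEcard; apply/andP; split.
    by apply/subsetP=> q qQ; rewrite stabE (subsetP sQH) // xQ /=.
  apply: (maxQ [group of 'C_H[x | a]]); rewrite /P subsetIl /=.
  apply/set0Pn; exists x; rewrite inE xA; apply/afixP=> h.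
  by rewrite stabE => /andP[_ /eqP].
have CyQ : 'C_H[y | b] = Q.
  apply/esym/eqP; rewrite eqEcard; apply/andP; split.
    by apply/subsetP=> q qQ; rewrite stabE (subsetP sQH) // yQ /=.
  apply: (maxQ [group of 'C_H[y | b]]); rewrite /P subsetIl /= -card_gt0 AB.
    apply/card_gt0P; exists y; rewrite inE yB; apply/afixP=> h.
    by rewrite stabE => /andP[_ /eqP].
  exact: subsetIl.
have [f fP] := orbit_iso (etrans CxQ (esym CyQ)).
have sxA := sub_orbit stA xA; have syB := sub_orbit stB yB.
case: (IHn (A :\: orbit a H x) (B :\: orbit b H y)).
- rewrite -ltnS (leq_trans _ leAn) // proper_card //; apply/properP.
  by split; [exact: subsetDl | exists x; rewrite // inE orbit_refl].
- exact: stable_orbitD.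
- exact: stable_orbitD.
- move=> R sRH; rewrite !card_fixD // AB //; congr (_ - _)%N.
  by apply: (card_fix_iso_on sRH _ fP); exact: stable_orbit.
move=> g [g_inj gA gJ]; have [f_inj fA fJ] := fP.
exists (fun z => if z \in orbit a H x then f z else g z).
have fO z : z \in orbit a H x -> f z \in orbit b H y.
  by move=> zO; rewrite -fA imset_f.
have gO z : z \in A -> z \notin orbit a H x ->
    g z \in B /\ g z \notin orbit b H y.
  by move=> zA zO; apply/setDP; rewrite -gA imset_f // inE zO.
split.
- move=> z w zA wA /=; case: ifPn => zO; case: ifPn => wO.
  + exact: f_inj.
  + by move=> fg; have [_] := gO w wA wO; rewrite -fg fO.
  + by move=> gf; have [_] := gO z zA zO; rewrite gf fO.
  + by apply: g_inj; rewrite inE ?zO ?wO.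
- apply/setP=> w; apply/imsetP/idP=> [[z zA ->]|wB].
    by case: ifPn => zO; [rewrite (subsetP syB) ?fO | have [] := gO z zA zO].
  have [wO|wO] := boolP (w \in orbit b H y).
    move: wO; rewrite -fA => /imsetP[z zO ->]; exists z; first exact: (subsetP sxA).
    by rewrite zO.
  have : w \in B :\: orbit b H y by rewrite inE wO.
  rewrite -gA => /imsetP[z /setDP[zA zO] ->]; exists z => //.
  by rewrite (negPf zO).
- move=> h z hH zA; rewrite (stable_mem z (@stable_orbit T a x) hH).
  by case: ifPn => zO; [exact: fJ | apply: gJ; rewrite // inE zO].
Qed.

(* Burnside: a finite H-set is determined by its numbers of fixed points. *)
Lemma card_fix_inj :
  (forall Q, Q \subset H -> #|'Fix_a(Q)| = #|'Fix_b(Q)|) -> gset_iso a b.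
Proof.
move=> ab.
have cardTU : #|T| = #|U|.
  have fix1 (V : finType) (c : action H V) : 'Fix_c(1%G) = [set: V].
    by apply/setP=> x; rewrite !inE sub1set inE act1 eqxx.
  by have:= ab 1%G (sub1G H); rewrite !fix1 !cardsT.
have [u0 _|U0] := pickP (fun _ : U => true); last first.
  have T0 : T -> False.
    by move=> x; have:= max_card (pred1 x); rewrite card1 cardTU eq_card0.
  exists (fun x => match T0 x with end); split; last by move=> h _ x; case: (T0 x).
  by apply: inj_card_bij => [x|]; [case: (T0 x) | rewrite cardTU].
have [|||f [f_inj fT fJ]] := @iso_on_ind u0 _ [set: T] [set: U] (leqnn _).
- by move=> h x; rewrite !inE.
- by move=> h x; rewrite !inE.
- by move=> Q sQH; rewrite !setTI ab.
exists f; split; last by move=> h hH x; apply: fJ.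
by apply: inj_card_bij; [move=> x y; apply: f_inj; rewrite inE | rewrite cardTU].
Qed.

End FixedPointsInjective.

End FixedPoints.

Section BurnsideRing.

Local Open Scope ring_scope.

Variables (gT : finGroupType) (H : {group gT}).

Definition burnside := groth (iso_class H).
HB.instance Definition _ := GRing.ComPzRing.on burnside.

Definition burnside_class (T : finType) (a : action H T) : burnside :=
  gclass (iso_cls a).

Section Mark.

Variables (Q : {group gT}) (sQH : Q \subset H).

Definition fix_card (c : iso_class H) : nat := #|'Fix_(repr_act c)(Q)|.

Definition mark of Q \subset H := fun x : burnside =>
  (fix_card (gpos x))%:Z - (fix_card (gneg x))%:Z.

Lemma fix_card_cls (T : finType) (a : action H T) :
  fix_card (iso_cls a) = #|'Fix_a(Q)|.
Proof. exact: card_fix_iso (repr_act_cls a). Qed.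

Lemma fix_cardD c d : fix_card (c + d) = (fix_card c + fix_card d)%N.
Proof.
elim/iso_class_ind: c => T a; elim/iso_class_ind: d => U b.
by rewrite -[_ + _]/(iso_add _ _) iso_addE !fix_card_cls card_fix_sum.
Qed.

Lemma fix_cardM c d : fix_card (c * d) = (fix_card c * fix_card d)%N.
Proof.
elim/iso_class_ind: c => T a; elim/iso_class_ind: d => U b.
by rewrite -[_ * _]/(iso_mul _ _) iso_mulE !fix_card_cls card_fix_prod.
Qed.

Lemma fix_card0 : fix_card 0 = 0.
Proof. by rewrite fix_card_cls eq_card0 // => -[]. Qed.

Lemma fix_card1 : fix_card 1 = 1%N.
Proof.
rewrite fix_card_cls (eq_card (_ : _ =i [set: unit])) ?cardsT ?card_unit //.
by move=> -[]; rewrite in_setT; apply/afixP.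
Qed.

Lemma mark_gdiff c d :
  mark sQH (gdiff c d) = (fix_card c)%:Z - (fix_card d)%:Z.
Proof.
have [z /(congr1 fix_card)] := gdiff_repr c d; rewrite !fix_cardD /mark; lia.
Qed.

Lemma mark_class (T : finType) (a : action H T) :
  mark sQH (burnside_class a) = #|'Fix_a(Q)|.
Proof. by rewrite mark_gdiff fix_card0 fix_card_cls subr0. Qed.

Lemma mark_is_zmod_morphism : zmod_morphism (mark sQH).
Proof.
elim/groth_ind=> a b; elim/groth_ind=> c d.
rewrite -[_ - _]/(groth_add _ (groth_opp _)) groth_oppE groth_addE !mark_gdiff.
by rewrite !fix_cardD; lia.
Qed.

Lemma mark_is_monoid_morphism : GRing.monoid_morphism (mark sQH).
Proof.
split; first by rewrite mark_gdiff fix_card0 fix_card1.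
elim/groth_ind=> a b; elim/groth_ind=> c d.
rewrite -[_ * _]/(groth_mul _ _) groth_mulE !mark_gdiff.
by rewrite !fix_cardD !fix_cardM !PoszD !PoszM; ring.
Qed.

HB.instance Definition _ :=
  GRing.isZmodMorphism.Build burnside int (mark sQH) mark_is_zmod_morphism.
HB.instance Definition _ :=
  GRing.isMonoidMorphism.Build burnside int (mark sQH) mark_is_monoid_morphism.

End Mark.

Lemma mark_inj (x y : burnside) :
  (forall (Q : {group gT}) (sQH : Q \subset H), mark sQH x = mark sQH y) -> x = y.
Proof.
elim/groth_ind: x => a b; elim/groth_ind: y => c d markE.
suff abcd : a + d = c + b by apply/gdiffP; exists 0; rewrite abcd.
move: markE; elim/iso_class_ind: a => Ta a; elim/iso_class_ind: b => Tb b.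
elim/iso_class_ind: c => Tc c; elim/iso_class_ind: d => Td d markE.
rewrite -[LHS]/(iso_add _ _) -[RHS]/(iso_add _ _) !iso_addE.
apply/iso_clsP/card_fix_inj=> Q sQH; have:= markE Q sQH.
rewrite !card_fix_sum !mark_gdiff !fix_card_cls //; lia.
Qed.

End BurnsideRing.

Section Restriction.

Local Open Scope ring_scope.

Variables (gT : finGroupType) (G H : {group gT}) (sHG : H \subset G).

Definition iso_res (c : iso_class G) : iso_class H := iso_cls (repr_act c \ sHG)%act.

Definition res (x : burnside G) : burnside H :=
  gdiff (iso_res (gpos x)) (iso_res (gneg x)).

Lemma iso_resE (T : finType) (a : action G T) :
  iso_res (iso_cls a) = iso_cls (a \ sHG)%act.
Proof.
apply/iso_clsP; have [f [f_bij fJ]] := repr_act_cls a.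
by exists f; split=> // h hH x; apply: fJ; apply: (subsetP sHG).
Qed.

Lemma iso_resD c d : iso_res (c + d) = iso_res c + iso_res d.
Proof.
elim/iso_class_ind: c => T a; elim/iso_class_ind: d => U b.
rewrite -[c in iso_res c]/(iso_add _ _) -[RHS]/(iso_add _ _).
rewrite iso_addE !iso_resE iso_addE; apply/iso_clsP.
by exists id; split; [exists id | move=> h _ []].
Qed.

Lemma iso_resM c d : iso_res (c * d) = iso_res c * iso_res d.
Proof.
elim/iso_class_ind: c => T a; elim/iso_class_ind: d => U b.
rewrite -[c in iso_res c]/(iso_mul _ _) -[RHS]/(iso_mul _ _).
rewrite iso_mulE !iso_resE iso_mulE; apply/iso_clsP.
by exists id; split; [exists id | move=> h _ []].
Qed.

Lemma iso_res0 : iso_res 0 = 0.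
Proof.
by rewrite iso_resE; apply/iso_clsP; exists id; split; [exists id | move=> h _ []].
Qed.

Lemma iso_res1 : iso_res 1 = 1.
Proof.
by rewrite iso_resE; apply/iso_clsP; exists id; split; [exists id | move=> h _ []].
Qed.

Lemma res_gdiff c d : res (gdiff c d) = gdiff (iso_res c) (iso_res d).
Proof.
have [z /(congr1 iso_res)] := gdiff_repr c d; rewrite !iso_resD => zE.
by apply/gdiffP; exists (iso_res z).
Qed.

Lemma res_class (T : finType) (a : action G T) :
  res (burnside_class a) = burnside_class (a \ sHG)%act.
Proof. by rewrite res_gdiff iso_res0 iso_resE. Qed.

Lemma res_is_zmod_morphism : zmod_morphism res.
Proof.
elim/groth_ind=> a b; elim/groth_ind=> c d.
rewrite -[_ - _]/(groth_add _ (groth_opp _)) groth_oppE groth_addE !res_gdiff.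
by rewrite !iso_resD -[RHS]/(groth_add _ (groth_opp _)) groth_oppE groth_addE.
Qed.

Lemma res_is_monoid_morphism : GRing.monoid_morphism res.
Proof.
split; first by rewrite res_gdiff iso_res0 iso_res1.
elim/groth_ind=> a b; elim/groth_ind=> c d.
rewrite -[_ * _]/(groth_mul _ _) groth_mulE !res_gdiff !iso_resD !iso_resM.
by rewrite -[RHS]/(groth_mul _ _) groth_mulE.
Qed.

HB.instance Definition _ :=
  GRing.isZmodMorphism.Build (burnside G) (burnside H) res res_is_zmod_morphism.
HB.instance Definition _ :=
  GRing.isMonoidMorphism.Build (burnside G) (burnside H) res res_is_monoid_morphism.

End Restriction.

Section CoInduction.

Variables (gT : finGroupType) (K H : {group gT}).

Section Action.

Variables (T : finType) (a : action K T).

(* Map_K(H, T), with H acting by (f h)(x) = f (h x); here [subg H k] is the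
   element k of K seen in H, so this is meant for K \subset H. *)
Record coind := CoInd {
  coind_val : {ffun subg_of H -> T};
  _ : [forall x, forall k in K, coind_val (x * subg H k) == a (coind_val x) k] }.
HB.instance Definition _ := [isSub for coind_val].
HB.instance Definition _ := [Finite of coind by <:].

Lemma coindP (f : coind) x k :
  k \in K -> coind_val f (x * subg H k) = a (coind_val f x) k.
Proof. by move=> kK; have /forallP/(_ x)/forall_inP/(_ k kK)/eqP := valP f. Qed.

Lemma coind_fun_subproof (f : coind) (h : gT) :
  let g := [ffun x => coind_val f (subg H h * x)] in
  [forall x, forall k in K, g (x * subg H k) == a (g x) k].
Proof.
apply/forallP=> x; apply/forall_inP=> k kK.
by rewrite !ffunE mulgA coindP.
Qed.

Definition coind_fun (f : coind) (h : gT) : coind := CoInd (coind_fun_subproof f h).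

Lemma coind_is_action : is_action H coind_fun.
Proof.
split=> [h f g /(congr1 val)/ffunP fg | f h k hH kH]; apply: val_inj; apply/ffunP=> x.
  by have:= fg ((subg H h)^-1 * x); rewrite !ffunE mulKVg.
rewrite !ffunE mulgA; congr (coind_val f (_ * _)).
by apply: val_inj; rewrite /= !subgK ?groupM.
Qed.
Definition coind_act : action H coind := Action coind_is_action.

End Action.

(* Representatives of the double cosets in Q\H/K. *)
Definition dcoset_reps (Q : {group gT}) : {set gT} :=
  [set fingroup.repr (Q * C) | C in lcosets K H].

Lemma card_dcoset_reps Q : K \subset H -> #|dcoset_reps Q| <= #|H : K|.
Proof. by move=> sKH; rewrite -card_lcosets leq_imset_card. Qed.

Lemma card_fix_coind (T : finType) (a : action K T) (Q : {group gT}) :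
  K \subset H -> Q \subset H ->
  #|'Fix_(coind_act a)(Q)| =
    (\prod_(d in dcoset_reps Q) #|'Fix_a(K :&: Q :^ d)|)%N.
Proof.
move=> sKH sQH; pose rep h := fingroup.repr (Q * (h *: K)).
have repP h : h \in H ->
    exists q k, [/\ q \in Q, k \in K & h = q * rep h * k].
  move=> hH; have: rep h \in Q * (h *: K).
    apply: (@mem_repr _ _ h).
    by rewrite -[X in X \in _]mul1g mem_mulg // lcoset_refl.
  case/mulsgP=> q _ qQ /lcosetP[k kK ->] ->.
  by exists q^-1, k^-1; rewrite !groupV; split=> //; rewrite mulKg mulgK.
have repM q h k : q \in Q -> k \in K -> rep (q * h * k) = rep h.
  move=> qQ kK; rewrite /rep; congr fingroup.repr.
  by rewrite -!mulg_set1 -!mulgA (lcoset_id kK) [LHS]mulgA (rcoset_id qQ).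
have repH h : h \in H -> rep h \in H.
  move=> hH; have [q [k [/(subsetP sQH) qH /(subsetP sKH) kH hE]]] := repP h hH.
  by rewrite -(groupMl _ qH) -(groupMr _ kH) -hE.
have rep_id h : h \in H -> rep (rep h) = rep h.
  by move=> hH; have [q [k [qQ kK hE]]] := repP h hH; rewrite [in RHS]hE repM.
have repsP d : reflect (exists2 h, h \in H & d = rep h) (d \in dcoset_reps Q).
  apply: (iffP imsetP) => [[_ /lcosetsP[h hH ->] ->]|[h hH ->]].
    by exists h.
  by exists (h *: K) => //; apply/lcosetsP; exists h.

have repsH d : d \in dcoset_reps Q -> d \in H by case/repsP=> h hH ->; exact: repH.
have decomp_eq (t : T) d q q' k k' : q \in Q -> q' \in Q -> k \in K -> k' \in K ->
    t \in 'Fix_a(K :&: Q :^ d) -> q * d * k = q' * d * k' -> a t k = a t k'.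
  move=> qQ q'Q kK k'K /afixP tfix E.
  have kV : k^-1 \in K by rewrite groupV.
  have {1}<- : a t (k' * k^-1) = t.
    apply: tfix; rewrite inE groupM //= mem_conjg /conjg invgK.
    have -> : k' = d^-1 * q'^-1 * (q * d * k) by rewrite E -!mulgA !mulKg.
    by rewrite !mulgA mulgV mul1g !mulgK groupM ?groupV.
  by rewrite -actMin ?groupM // mulgKV.
have repD (x : subg_of H) : rep (val x) \in dcoset_reps Q.
  by apply/repsP; exists (val x); rewrite // (valP x).
pose S : finType := {x in dcoset_reps Q}.
pose rd (x : subg_of H) : S := exist _ (rep (val x)) (repD x).
pose Phi (f : coind a) := [ffun d : S => coind_val f (subg H (val d))].
pose F (d : S) := [pred t | t \in 'Fix_a(K :&: Q :^ val d)].
have fixE (f : coind a) q x : f \in 'Fix_(coind_act a)(Q) -> q \in Q ->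
    coind_val f (subg H q * x) = coind_val f x.
  move=> /afixP fQ /fQ /(congr1 (fun g => coind_val g x)).
  by rewrite ffunE.
have decomp (x : subg_of H) : exists2 k, k \in K &
    exists2 q, q \in Q & val x = q * rep (val x) * k.
  by have [q [k [qQ kK xE]]] := repP (val x) (valP x); exists k => //; exists q.
have valE (f : coind a) q (x : subg_of H) k : f \in 'Fix_(coind_act a)(Q) ->
    q \in Q -> k \in K ->
    val x = q * rep (val x) * k -> coind_val f x = a (Phi f (rd x)) k.
  move=> fQ qQ kK xE; rewrite ffunE -coindP // -[RHS](fixE f q) //.
  congr (coind_val f _); apply: val_inj.
  have dH : rep (val x) \in H by apply: repH; exact: valP.
  have qH := subsetP sQH q qQ; have kH := subsetP sKH k kK.
  by rewrite [LHS]xE /= !subgK // mulgA.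
have Phi_inj : {in 'Fix_(coind_act a)(Q) &, injective Phi}.
  move=> f g fQ gQ fg; apply: val_inj; apply/ffunP=> x /=.
  have [k kK [q qQ xE]] := decomp x.
  by rewrite (valE f q x k) // (valE g q x k) // fg.
rewrite -(card_in_imset Phi_inj).
transitivity #|(family F : simpl_pred {ffun S -> T})|; last first.
  by rewrite big_sub card_family foldrE big_map big_enum /=; apply: eq_bigr.
apply: eq_card=> g; apply/imsetP/familyP => [[f fQ ->] d | gF].
  apply/afixP=> k /setIP[kK]; rewrite mem_conjg /conjg invgK => kQ.
  have dH := repsH _ (valP d); have kH := subsetP sKH k kK.
  rewrite ffunE -coindP // -[RHS](fixE f _ _ fQ kQ) //; congr (coind_val f _).
  have qH := subsetP sQH _ kQ.
  by apply: val_inj; rewrite /= !subgK // !mulgA mulgKV.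
have kx_ex (x : subg_of H) :
    exists k, (k \in K) && [exists q in Q, val x == q * rep (val x) * k].
  have [k kK [q qQ xE]] := decomp x; exists k; rewrite kK.
  by apply/exists_inP; exists q => //; apply/eqP.
pose kx (x : subg_of H) := xchoose (kx_ex x).
have kxK (x : subg_of H) : kx x \in K by have /andP[] := xchooseP (kx_ex x).
have kxE (x : subg_of H) : exists2 q, q \in Q & val x = q * rep (val x) * kx x.
  have /andP[_ /exists_inP[q qQ /eqP xE]] := xchooseP (kx_ex x).
  by exists q.
pose f0 : {ffun subg_of H -> T} := [ffun x => a (g (rd x)) (kx x)].
have f0E q (x : subg_of H) k : q \in Q -> k \in K -> val x = q * rep (val x) * k ->
    f0 x = a (g (rd x)) k.
  move=> qQ kK xE; rewrite ffunE; have [q' q'Q xE'] := kxE x.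
  exact: decomp_eq q'Q qQ (kxK x) kK (gF (rd x)) (etrans (esym xE') xE).
have rdE (x y : subg_of H) : rep (val x) = rep (val y) -> rd x = rd y.
  by move=> xy; apply: val_inj.
have f0P : [forall x, forall k in K, f0 (x * subg H k) == a (f0 x) k].
  apply/forallP=> x; apply/forall_inP=> k kK; apply/eqP.
  have kH := subsetP sKH k kK; have [q qQ xE] := kxE x.
  have repE : rep (val (x * subg H k)) = rep (val x).
    by have := repM 1 (val x) k (group1 Q) kK; rewrite mul1g /= subgK.
  rewrite (f0E q _ (kx x * k)) ?groupM //; last first.
    by rewrite repE /= subgK // [in LHS]xE !mulgA.
  by rewrite (rdE _ _ repE) actMin // ffunE.
have fQ : CoInd f0P \in 'Fix_(coind_act a)(Q).
  apply/afixP=> q qQ; apply: val_inj; apply/ffunP=> x; rewrite ffunE /=.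
  have qH := subsetP sQH q qQ; have [q' q'Q xE] := kxE x.
  have repE : rep (val (subg H q * x)) = rep (val x).
    by have := repM q (val x) 1 qQ (group1 K); rewrite mulg1 /= subgK.
  rewrite (f0E (q * q') _ (kx x)) ?groupM //; last first.
    by rewrite repE /= subgK // [in LHS]xE !mulgA.
  by rewrite (rdE _ _ repE) ffunE.
exists (CoInd f0P) => //; apply/ffunP=> d; rewrite ffunE /=.
have dH := repsH _ (valP d).
have dE : rep (val (subg H (val d))) = val d.
  by rewrite subgK //; have /repsP[h hH ->] := valP d; exact: rep_id.
rewrite (f0E 1 _ 1) ?group1 //; last by rewrite dE subgK // mul1g mulg1.
by rewrite act1; congr (g _); apply: val_inj; rewrite /= dE.
Qed.
End CoInduction.

Section Norm.

Local Open Scope ring_scope.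

Variables (gT : finGroupType) (K H : {group gT}) (sKH : K \subset H).

(* Coinduction X |-> Map_K(H, X) is a polynomial map of degree at most
   n = |H : K| from finite K-sets to A(H), and the norm is its unique extension
   to a polynomial map on A(K).  A polynomial p of degree at most n satisfies
     p(-1) = \sum_(0 <= j <= n) (-1)^j 'C(n+1, j+1) p(j),
   so the norm of X - Y is given by the coinductions of X + jY, 0 <= j <= n.
   See norm_class and mark_norm below: the value does not depend on the chosen
   representative X - Y, and is Map_K(H, X) on an actual K-set X. *)
Definition norm of K \subset H := fun x : burnside K =>
  \sum_(j < #|H : K|.+1)
     burnside_class (coind_act H (repr_act (gpos x + gneg x *+ j)))
       *~ ((-1) ^+ j * 'C(#|H : K|.+1, j.+1)%:R).

End Norm.

Lemma alt_sum_bin_prod (R : comPzRingType) (s : seq (R * R)) m :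
  (size s < m)%N ->
  (\sum_(i < m.+1) (-1) ^+ i * 'C(m, i)%:R *
     \prod_(u <- s) (u.1 + u.2 *+ i) = 0 :> R)%R.
Proof.
move: {2}(size s) (erefl (size s)) => r; elim: r s m => [|r IHr] s [|m] sr; rewrite sr // => lt_rm.
  have := @exprDn R 1 (-1) m.+1; rewrite subrr expr0n /= => E.
  rewrite [RHS]E; apply: eq_bigr => i _.
  by rewrite (size0nil sr) big_nil mulr1 expr1n mul1r mulr_natr.
case: s sr => [|[p q] s] //= [sr]; rewrite ltnS in lt_rm.
pose f (i : nat) : R := (\prod_(u <- s) (u.1 + u.2 *+ i))%R.
transitivity (p * (\sum_(i < m.+2) (-1) ^+ i * 'C(m.+1, i)%:R * f i) +
  q * \sum_(i < m.+2) (-1) ^+ i * ('C(m.+1, i) * i)%:R * f i)%R.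
  rewrite !mulr_sumr -big_split; apply: eq_bigr => i _ /=.
  by rewrite big_cons /= -/(f i) natrM -[(q *+ i)%R]mulr_natr; ring.
rewrite IHr ?sr // 1?ltnW // mulr0 add0r big_ord_recl muln0 mulr0 mul0r add0r.
transitivity (- (q * m.+1%:R * \sum_(i < m.+1) (-1) ^+ i * 'C(m, i)%:R *
   \prod_(u <- [seq (u.1 + u.2, u.2) | u <- s]) (u.1 + u.2 *+ i)))%R.
  rewrite -[(q * _ * _)%R]mulrA -mulrN; congr (_ * _)%R.
  rewrite mulr_sumr -sumrN; apply: eq_bigr => i _.
  rewrite /f big_map lift0 mulnC -mul_bin_diag natrM exprS /=.
  under eq_bigr => u _ do rewrite mulrS addrA.
  by ring.
by rewrite IHr ?mulr0 ?oppr0 // size_map sr.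
Qed.

Section NormTheory.

Local Open Scope ring_scope.

Variables (gT : finGroupType) (K H : {group gT}) (sKH : K \subset H).

Lemma mark_norm (Q : {group gT}) (sQH : Q \subset H) (x : burnside K) :
  mark sQH (norm sKH x) =
  \prod_(d in dcoset_reps K H Q) mark (subsetIl K (Q :^ d)) x.
Proof.
pose p d := fix_card (K :&: Q :^ d)%G (gpos x).
pose q d := fix_card (K :&: Q :^ d)%G (gneg x).
pose s := [seq ((p d)%:Z - (q d)%:Z, (q d)%:Z) | d <- enum (dcoset_reps K H Q)].
have := @alt_sum_bin_prod int s #|H : K|.+1.
rewrite size_map -cardE ltnS card_dcoset_reps // => /(_ isT).
rewrite big_ord_recl expr0 bin0 !mul1r => /(canRL (addrK _)).
rewrite sub0r /s big_map big_enum /=.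
under eq_bigr => d _ do rewrite mulr0n addr0 -[_ - _]/(mark (subsetIl K (Q :^ d)) x).
move=> ->; rewrite raddf_sum -sumrN; apply: eq_bigr => j _ /=.
rewrite raddfMz /= mark_class card_fix_coind //.
rewrite (big_morph Posz PoszM (erefl 1%:Z)) big_map big_enum /=.
rewrite /bump leq0n add1n exprS mulN1r !mulNr opprK mulrzz mulrC.
congr (_ * _); apply: eq_bigr => d _.
rewrite -/(fix_card (K :&: Q :^ d)%G _) fix_cardD ?subsetIl //.
have -> : fix_card (K :&: Q :^ d)%G (gneg x *+ j) = (q d * j)%N.
  elim: (nat_of_ord j) => [|i IHi].
    by rewrite mulr0n fix_card0 ?subsetIl // muln0.
  by rewrite mulrS fix_cardD ?subsetIl // IHi mulnS.
by rewrite -/(p d) -mulr_natr natz; lia.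
Qed.
Lemma norm_class (T : finType) (a : action K T) :
  norm sKH (burnside_class a) = burnside_class (coind_act H a).
Proof.
apply: mark_inj => Q sQH; rewrite mark_norm mark_class card_fix_coind //.
by rewrite (big_morph Posz PoszM (erefl 1%:Z)); apply: eq_bigr => d _; rewrite mark_class.
Qed.

Lemma norm_is_monoid_morphism : GRing.monoid_morphism (norm sKH).
Proof.
split=> [|x y]; apply: mark_inj => Q sQH; rewrite mark_norm.
  by rewrite [RHS]rmorph1 big1 // => d _; rewrite rmorph1.
by rewrite [RHS]rmorphM /= !mark_norm -big_split; apply: eq_bigr => d _; rewrite rmorphM.
Qed.

End NormTheory.

Section Idempotents.

Variable gT : finGroupType.
Implicit Types G H K L Q N : {group gT}.

Definition perfect Q := [~: Q, Q] == Q.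

(* O^solv(Q), the least normal subgroup of Q with solvable quotient. *)
Definition Osolv Q : {set gT} :=
  \bigcap_(N : {group gT} | (N <| Q) && solvable (Q / N)) N.
Canonical Osolv_group Q := [group of Osolv Q].

Lemma Osolv_min Q N : N <| Q -> solvable (Q / N) -> Osolv Q \subset N.
Proof. by move=> nNQ solN; apply: bigcap_inf; rewrite nNQ. Qed.

Lemma Osolv_normal Q : Osolv Q <| Q.
Proof.
apply/andP; split.
  by apply: Osolv_min; rewrite ?normal_refl // trivg_quotient solvable1.
by apply: norms_bigcap; apply/bigcapsP=> N /andP[/normal_norm].
Qed.

Lemma Osolv_solvable Q : solvable (Q / Osolv Q).
Proof.
pose P N := (N <| Q) && solvable (Q / N).
have sol N : exists n, P N ==> (Q^`(n) \subset N).
  have [/andP[/normal_norm nNQ /derivedP[n n1]]|_] := boolP (P N); last by exists 0.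
  exists n; rewrite -quotient_sub1 ?(subset_trans (der_sub n Q)) //.
  by rewrite quotient_der // n1 subxx.
pose f N := ex_minn (sol N); pose m := (\max_N f N)%N.
have der_mono n k : Q^`(n + k) \subset Q^`(n).
  elim: k => [|k IHk]; first by rewrite addn0.
  by rewrite addnS (subset_trans (der_subS _ _)).
have sQm : Q^`(m) \subset Osolv Q.
  apply/bigcapsP=> N PN; have : Q^`(f N) \subset N.
    by rewrite /f; case: ex_minnP => n; rewrite [P N]PN.
  apply: subset_trans; rewrite -(subnKC (leq_bigmax N : f N <= m)); exact: der_mono.
apply/derivedP; exists m; rewrite -quotient_der ?(normal_norm (Osolv_normal Q)) //.
apply/trivgP; rewrite quotient_sub1 // (subset_trans (der_sub m Q)) //.
exact: normal_norm (Osolv_normal Q).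
Qed.

Lemma perfectP Q : reflect (Osolv Q = Q) (perfect Q).
Proof.
apply: (iffP eqP) => [Q'Q | OQ].
  have : Q / Osolv Q = 1.
    apply/eqP; case: (eqVneq (Q / Osolv Q) 1) => // ntQ.
    have := sol_der1_proper (Osolv_solvable Q) (subxx _) ntQ.
    by rewrite -quotient_der ?(normal_norm (Osolv_normal Q)) // derg1 Q'Q properxx.
  move=> Q1; apply/eqP; rewrite eqEsubset (normal_sub (Osolv_normal Q)) /=.
  by rewrite -quotient_sub1 ?(normal_norm (Osolv_normal Q)) // Q1 subxx.
rewrite -derg1; apply/eqP; rewrite eqEsubset der_sub /= -{1}OQ.
exact: Osolv_min (der_normal 1 Q) (abelian_sol (der_abelian 0 Q)).
Qed.

(* For L perfect, this says that e is the primitive idempotent e_L of A(G): by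
   Dress such an e exists, and it is unique because the marks are jointly
   injective. *)
Definition dress_idempotent G L (e : burnside G) : Prop :=
  forall Q (sQG : Q \subset G), mark sQG e = (Osolv Q \in L :^: G)%:R%R.

Lemma dress_idempotent_uniq G L (e f : burnside G) :
  dress_idempotent L e -> dress_idempotent L f -> e = f.
Proof. by move=> eL fL; apply: mark_inj => Q sQG; rewrite eL fL. Qed.

Lemma dress_idempotent_mulrr G L (e : burnside G) :
  dress_idempotent L e -> (e * e)%R = e.
Proof.
move=> eL; apply: mark_inj => Q sQG.
by rewrite rmorphM /= eL -natrM mulnb andbb.
Qed.

End Idempotents.

(* Main.v *)
Require Import Defs.
From mathcomp Require Import all_boot all_order all_algebra all_fingroup.
From mathcomp Require Import all_solvable.

Set Implicit Arguments.
Unset Strict Implicit.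
Unset Printing Implicit Defensive.

Import GRing.Theory Num.Theory.

(** Write e_K and e_H for the restrictions of e to K and H.  They are
    idempotent, so localizing at them only forces them to become 1: every
    fraction is the image of its numerator, and two elements have the same
    image exactly when their products with the idempotent agree.  Hence a
    multiplicative map f descends as soon as it respects the single new
    relation e_K = 1, that is, if and only if e_H * f e_K = e_H
    ([descends_to_idempotent_loc]).

    For the norm this equation is tested on marks.  At a subgroup Q of H whose
    solvable residual O(Q) is conjugate to L it says, by the double coset
    formula for the marks of a norm, that O(K :&: Q :^ d) is conjugate to L for
    every double coset representative d.

    If K contains every G-conjugate of L lying in H, then it contains O(Q) :^ d,
    so K :&: Q :^ d lies between O(Q :^ d) and Q :^ d.  As O is monotone and
    fixes O(Q :^ d), a conjugate of the perfect group L, all three groups have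
    the same residual ([Osolv_between]).  Conversely, for L' in H conjugate to
    L, take Q = L' and d in the double coset of 1: a subgroup of L' :^ d whose
    residual has the order of L' is L' :^ d itself, so L' :^ d is contained in
    K, and so is L' since d lies in L' * K. *)

Section IdempotentLocalization.

Local Open Scope ring_scope.

Lemma idempotent_expr_absorb (R : comPzRingType) (s : R) n :
  s * s = s -> s * s ^+ n = s.
Proof. by move=> ss; elim: n => [|n IHn]; rewrite ?mulr1 // exprS mulrA ss. Qed.

Lemma to_loc_idempotent_eqP (R : comPzRingType) (s a b : R) :
  s * s = s -> to_loc s a = to_loc s b <-> s * a = s * b.
Proof.
move=> ss; rewrite lfracP; split=> [[k] | sab]; last first.
  by exists 1%N; rewrite expr0 !mul1r expr1.
rewrite expr0 !mul1r => /(congr1 ( *%R s)).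
by rewrite !mulrA idempotent_expr_absorb.
Qed.

Lemma lfrac_idempotent (R : comPzRingType) (s : R) a n :
  s * s = s -> lfrac s a n = to_loc s a.
Proof.
move=> ss; apply/lfracP; exists 1%N.
by rewrite expr0 expr1 mul1r mulrA idempotent_expr_absorb.
Qed.

(** The image of s in the localization is 1, which gives the necessity; it is
    sufficient because t * f a = t * f s * f a = t * f (s * a) then depends on
    s * a only. *)
Lemma descends_to_idempotent_loc (R S : comPzRingType) (s : R) (t : S)
    (f : R -> S) (ss : s * s = s) (tt : t * t = t) (fM : GRing.monoid_morphism f) :
  (exists Nt : loc s -> loc t, GRing.monoid_morphism Nt /\
     forall x, Nt (to_loc s x) = to_loc t (f x)) <-> t * f s = t.
Proof.
have [f1 fMul] := fM; split=> [[Nt [[Nt1 _] NtE]] | tfs].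
  rewrite -[RHS]mulr1; apply/to_loc_idempotent_eqP=> //.
  have s1 : to_loc s s = 1.
    by rewrite -(rmorph1 (to_loc s)); apply/to_loc_idempotent_eqP; rewrite ?mulr1.
  by rewrite -NtE s1 Nt1 rmorph1.
have Nt_wd a b : to_loc s a = to_loc s b -> to_loc t (f a) = to_loc t (f b).
  move=> /(to_loc_idempotent_eqP _ _ ss) sab; apply/to_loc_idempotent_eqP=> //.
  by rewrite -tfs -!mulrA -!fMul sab.
have numK x : to_loc s (lnum x) = x by rewrite -[RHS]lfracK lfrac_idempotent.
have NtE x : to_loc t (f (lnum (to_loc s x))) = to_loc t (f x) by exact/Nt_wd/numK.
exists (fun x => to_loc t (f (lnum x))); split=> //; split=> [|x y].
  by rewrite -(rmorph1 (to_loc s)) NtE f1 rmorph1.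
by rewrite -{1}(numK x) -{1}(numK y) -rmorphM NtE fMul rmorphM.
Qed.

End IdempotentLocalization.

Section SolvableResidual.

Local Open Scope group_scope.

Variable gT : finGroupType.
Implicit Types A B L P Q : {group gT}.

Lemma Osolv_sub_der Q n : Osolv Q \subset Q^`(n).
Proof.
apply: Osolv_min (der_normal n Q) _; apply/derivedP; exists n.
by rewrite -quotient_der ?(normal_norm (der_normal n Q)) // trivg_quotient.
Qed.

(** The derived series stabilizes at the solvable residual; this transfers
    monotonicity and compatibility with conjugation from the former to the
    latter. *)
Lemma Osolv_eq_der Q : exists n, Osolv Q = Q^`(n).
Proof.
have nOQ := normal_norm (Osolv_normal Q).
have /derivedP[n Qn1] := Osolv_solvable Q; exists n.
apply/eqP; rewrite eqEsubset Osolv_sub_der.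
by rewrite -quotient_sub1 ?(subset_trans (der_sub n Q)) // quotient_der ?Qn1 ?sub1G.
Qed.

Lemma OsolvS A B : A \subset B -> Osolv A \subset Osolv B.
Proof.
move=> sAB; have [n ->] := Osolv_eq_der B.
exact: subset_trans (Osolv_sub_der A n) (dergS n sAB).
Qed.

Lemma OsolvJ Q x : Osolv (Q :^ x) = Osolv Q :^ x.
Proof.
have sJ P y : Osolv (P :^ y) \subset Osolv P :^ y.
  by have [n ->] := Osolv_eq_der P; rewrite -derJ; exact: Osolv_sub_der.
apply/eqP; rewrite eqEsubset sJ sub_conjg.
have {1}-> : Q = ((Q :^ x) :^ x^-1)%G by apply: val_inj; rewrite /= conjsgK.
exact: sJ.
Qed.

Lemma perfectJ L x : perfect L -> perfect (L :^ x)%G.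
Proof. by move=> /eqP pL; apply/eqP; rewrite -conjsRg pL. Qed.

Lemma perfect_conj L Q (D : {set gT}) :
  perfect L -> gval Q \in L :^: D -> perfect Q.
Proof.
move=> pL /imsetP[x _ Qx]; have -> : Q = (L :^ x)%G by exact: val_inj.
exact: perfectJ.
Qed.

Lemma Osolv_between L P Q :
  perfect L -> Osolv Q = L -> L \subset P -> P \subset Q -> Osolv P = L.
Proof.
move=> /perfectP OL OQ /OsolvS sLP /OsolvS sPQ.
by apply/eqP; rewrite eqEsubset -{1}OQ sPQ -{1}OL.
Qed.

End SolvableResidual.

Section DressNorm.

Local Open Scope ring_scope.

Variable gT : finGroupType.
Implicit Types G H K L Q : {group gT}.

Lemma mark_res G H Q (sHG : H \subset G) (sQH : Q \subset H) (x : burnside G) :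
  mark sQH (res sHG x) = mark (subset_trans sQH sHG) x.
Proof.
elim/groth_ind: x => a b; rewrite res_gdiff !mark_gdiff.
elim/iso_class_ind: a => T a; elim/iso_class_ind: b => U b.
by rewrite !iso_resE !fix_card_cls // (subset_trans sQH sHG).
Qed.

Lemma mem_dcoset_reps K H Q d :
  d \in dcoset_reps K H Q -> exists2 h, h \in H & d \in (Q * (h *: K))%g.
Proof.
case/imsetP=> _ /lcosetsP[h hH ->] ->; exists h => //.
by apply: (mem_repr h); rewrite -[h in h \in _]mul1g mem_mulg ?lcoset_refl.
Qed.

Lemma dcoset_reps_sub K H Q : K \subset H -> Q \subset H ->
  dcoset_reps K H Q \subset H.
Proof.
move=> sKH sQH; apply/subsetP=> d /mem_dcoset_reps[h hH].
by apply/subsetP; rewrite !mul_subG // ?sub1set.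
Qed.

Lemma dcoset_reps1 K H Q :
  exists2 d, d \in dcoset_reps K H Q & d \in (Q * K)%g.
Proof.
exists (fingroup.repr (Q * (1 *: K))%g).
  by apply/imset_f/lcosetsP; exists 1%g.
by rewrite lcoset1; apply: (mem_repr 1%g); rewrite -[1%g]mul1g mem_mulg.
Qed.

Lemma prodr_bool_eq1 (I : finType) (D : {set I}) (b : pred I) :
  \prod_(d in D) (b d)%:R = 1 :> int <-> {in D, forall d, b d}.
Proof.
rewrite -natr_prod; split=> [/eqP | bD]; last by rewrite big1 // => d /bD->.
rewrite pnatr_eq1 => /eqP P1 d dD; move: P1; rewrite (bigD1 d) //=.
by case: (b d).
Qed.

Lemma dress_norm_absorbP G L K H (e : burnside G)
    (sKH : K \subset H) (sHG : H \subset G) : dress_idempotent L e ->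
  res sHG e * norm sKH (res (subset_trans sKH sHG) e) = res sHG e
  <-> forall Q, Q \subset H -> Osolv Q \in (L :^: G)%g ->
        {in dcoset_reps K H Q, forall d, Osolv (K :&: Q :^ d) \in (L :^: G)%g}.
Proof.
move=> eL.
have markE Q (sQH : Q \subset H) :
    mark sQH (res sHG e * norm sKH (res (subset_trans sKH sHG) e)) =
    (Osolv Q \in (L :^: G)%g)%:R *
    \prod_(d in dcoset_reps K H Q) (Osolv (K :&: Q :^ d) \in (L :^: G)%g)%:R.
  rewrite rmorphM /= mark_res eL mark_norm; congr (_ * _).
  by apply: eq_bigr => d _; rewrite mark_res eL.
split=> [absorb Q sQH OQ | OKQ].
  apply/(prodr_bool_eq1 _ (fun d => Osolv (K :&: Q :^ d) \in (L :^: G)%g)).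
  by have := markE Q sQH; rewrite absorb mark_res eL OQ mul1r.
apply: mark_inj => Q sQH; rewrite markE mark_res eL.
case: (boolP (_ \in _)) => OQ; last by rewrite mul0r.
rewrite mul1r.
exact/(prodr_bool_eq1 _ (fun d => Osolv (K :&: Q :^ d) \in (L :^: G)%g))/OKQ.
Qed.

Lemma residual_condP G L K H (pL : perfect L)
    (sKH : K \subset H) (sHG : H \subset G) :
  (forall Q, Q \subset H -> Osolv Q \in (L :^: G)%g ->
     {in dcoset_reps K H Q, forall d, Osolv (K :&: Q :^ d) \in (L :^: G)%g})
  <-> forall L', L' \subset H -> gval L' \in (L :^: G)%g -> L' \subset K.
Proof.
split=> [OKQ L' sL'H L'L | star Q sQH OQ d dD].
  have OL' := elimT (perfectP L') (perfect_conj pL L'L).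
  have [d dD /mulsgP[q k qL' kK dE]] := dcoset_reps1 K H L'.
  have := OKQ L' sL'H; rewrite OL' => /(_ L'L d dD).
  have cardL (A : {set gT}) : A \in (L :^: G)%g -> #|A| = #|L|.
    by case/imsetP=> x _ ->; rewrite cardJg.
  move=> /cardL OK; have sOK := normal_sub (Osolv_normal (K :&: L' :^ d)%G).
  (* The residual of K :&: L' :^ d already has the order of L' :^ d. *)
  have : (L' :^ d)%g \subset K.
    apply/setIidPr/eqP; rewrite eqEcard subsetIr cardJg (cardL _ L'L) -OK.
    exact: subset_leq_card sOK.
  by rewrite dE conjsgM (conjGid qL') sub_conjg (conjGid (groupVr kK)).
have dH := subsetP (dcoset_reps_sub sKH sQH) d dD.
have OQd : (Osolv Q :^ d)%g \in (L :^: G)%g.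
  case/imsetP: OQ => x xG ->; rewrite -conjsgM.
  by apply/imset_f/groupM/(subsetP sHG).
have sOK : (Osolv Q :^ d)%G \subset K.
  apply: star OQd; rewrite -(conjGid dH) conjSg.
  exact: subset_trans (normal_sub (Osolv_normal Q)) sQH.
rewrite (@Osolv_between _ (Osolv Q :^ d)%G _ (Q :^ d)%G) ?OsolvJ ?subsetIr //.
  exact: (@perfect_conj _ _ (Osolv Q :^ d)%G _ pL OQd).
by rewrite subsetI sOK conjSg normal_sub ?Osolv_normal.
Qed.

End DressNorm.

Theorem theoremA (gT : finGroupType) (G L K H : {group gT})
    (sLG : L \subset G) (perfL : perfect L)
    (e : burnside G) (eL : dress_idempotent L e)
    (sKH : K \subset H) (sHG : H \subset G) :
  (exists Nt : loc (res (subset_trans sKH sHG) e) -> loc (res sHG e),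
      GRing.monoid_morphism Nt /\
      forall x : burnside K,
        Nt (to_loc (res (subset_trans sKH sHG) e) x) =
        to_loc (res sHG e) (norm sKH x))
  <->
  (forall L' : {group gT},
      L' \subset H -> gval L' \in (L :^: G)%g -> L' \subset K).
Proof.
have ee := dress_idempotent_mulrr eL.
apply: iff_trans (descends_to_idempotent_loc _ _ _) _.
- by rewrite -rmorphM ee.
- by rewrite -rmorphM ee.
- exact: norm_is_monoid_morphism.
apply: iff_trans (dress_norm_absorbP sKH sHG eL) _.
exact: residual_condP.
Qed.
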